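(* (a) Let $A_\infty>B$ and $h_0>h_2$ be the constants of the convective condition in problem (P1), and let $\xi_2$ be the corresponding coefficient of the solution of (P1). If $$\frac{\frac{Bk_3}{h_0\sqrt{\pi\alpha_3}}+A_\infty\operatorname{erf}\left(\xi_2\sqrt{\frac{\alpha_1}{\alpha_3}}\right)}{\frac{k_3}{h_0\sqrt{\pi\alpha_3}}+\operatorname{erf}\left(\xi_2\sqrt{\frac{\alpha_1}{\alpha_3}}\right)}>B,$$ then the solution of problem (P2) with $$A=\frac{\frac{Bk_3}{h_0\sqrt{\pi\alpha_3}}+A_\infty\operatorname{erf}\left(\xi_2\sqrt{\frac{\alpha_1}{\alpha_3}}\right)}{\frac{k_3}{h_0\sqrt{\pi\alpha_3}}+\operatorname{erf}\left(\xi_2\sqrt{\frac{\alpha_1}{\alpha_3}}\right)}$$ coincides with the solution of problem (P1). (b) Let $A>B$ be the datum of the temperature condition in problem (P2), let $\mu_2$ be the corresponding coefficient of the solution of (P2), and let $A_\infty>A$. If $$\frac{A-B}{(A_\infty-A)\operatorname{erf}\left(\mu_2\sqrt{\frac{\alpha_1}{\alpha_3}}\right)}>\frac{B-C}{A_\infty-B}\sqrt{\frac{k_2c_2}{k_3c_3}}\;\frac{1}{\operatorname{erf}\left(z_0\sqrt{\frac{\alpha_1}{\alpha_2}}\right)},$$ then the solution of problem (P1) with bulk temperature $A_\infty$ and $$h_0=\frac{k_3}{\sqrt{\alpha_3\pi}}\,\frac{A-B}{A_\infty-A}\,\frac{1}{\operatorname{erf}\left(\mu_2\sqrt{\frac{\alpha_1}{\alpha_3}}\right)}$$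 coincides with the solution of problem (P2).
   Context: Data: positive constants $\rho$, $k_i,c_i$ ($i=1,2,3$), $\ell_1,\ell_2$; $\alpha_i=\frac{k_i}{\rho c_i}$, $\delta_i=\rho\ell_i$ ($i=1,2$); it is assumed that $\alpha_2>\alpha_3$. Real temperatures $B>C>D$. Common system (S): find $\Phi_3$ (on $0<x<y_2(t)$), $\Phi_2$ (on $y_2(t)<x<y_1(t)$), $\Phi_1$ (on $x>y_1(t)$) and free boundaries $y_1,y_2$ such that, for $t>0$: $\partial_t\Phi_i=\alpha_i\partial_{xx}\Phi_i$ in the respective region; $\Phi_3(y_2(t),t)=\Phi_2(y_2(t),t)=B$; $\Phi_2(y_1(t),t)=\Phi_1(y_1(t),t)=C$; $\Phi_1(x,0)=\Phi_1(+\infty,t)=D$ (as limits); $k_2\partial_x\Phi_2(y_2(t),t)-k_3\partial_x\Phi_3(y_2(t),t)=\delta_2\dot y_2(t)$; $k_1\partial_x\Phi_1(y_1(t),t)-k_2\partial_x\Phi_2(y_1(t),t)=\delta_1\dot y_1(t)$; $y_1(0)=y_2(0)=0$. (P1) is (S) with $k_3\partial_x\Phi_3(0,t)=\frac{h_0}{\sqrt t}(\Phi_3(0,t)-A_\infty)$, $t>0$, where $h_0>0$, $A_\infty>B$. (P2) is (S) with $\Phi_3(0,t)=A$, $t>0$, where $A>B$. ''The solution'' means the unique similarity-type solution, i.e. of the form $\Phi_i=A_i+B_i\operatorname{erf}\left(\frac{x}{2\sqrt{\alpha_it}}\right)$ with real constants $A_i,B_i$ and $y_i(t)=2\eta_i\sqrt{\alpha_1t}$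 with $0<\eta_2<\eta_1$. Two solutions coincide if their free boundaries and all three temperatures are equal. Functions: $\operatorname{erf}^{-1}:(-1,1)\to\mathbb R$ is the inverse of $\operatorname{erf}$, $\operatorname{erfc}=1-\operatorname{erf}$, $\mathrm{Ste}_1=\frac{c_1(C-D)}{\ell_1}$, $\mathrm{Ste}_2=\frac{c_2(B-C)}{\ell_2}$, and $$\varphi(z)=z+\frac{\mathrm{Ste}_1}{\sqrt\pi}\frac{\exp(-z^2)}{\operatorname{erfc}(z)},\qquad H(z)=\operatorname{erf}\left(z\sqrt{\tfrac{\alpha_1}{\alpha_2}}\right)-\frac{\mathrm{Ste}_2}{\sqrt\pi}\frac{\ell_2}{\ell_1}\sqrt{\frac{k_2c_1}{k_1c_2}}\,\frac{\exp\left(-z^2\frac{\alpha_1}{\alpha_2}\right)}{\varphi(z)},$$ $$Q(z)=\frac{\ell_1}{\ell_2}\varphi(z)\exp\left(z^2\tfrac{\alpha_1}{\alpha_2}\right)\qquad(z\ge0),$$ $$T(z)=\frac{\mathrm{Ste}_2}{\sqrt\pi\,c_2}\frac{A_\infty-B}{B-C}\sqrt{\frac{k_3c_1c_3}{k_1}}\;\frac{\exp\left(-z^2\alpha_1\left(\frac1{\alpha_3}-\frac1{\alpha_2}\right)\right)}{\frac{k_3}{h_0\sqrt{\pi\alpha_3}}+\operatorname{erf}\left(z\sqrt{\frac{\alpha_1}{\alpha_3}}\right)}-z\exp\left(z^2\tfrac{\alpha_1}{\alpha_2}\right)\qquad(z\ge0),$$ $$V(z)=\frac{A-B}{\ell_2}\sqrt{\frac{c_1c_3k_3}{\pi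 k_1}}\;\frac{\exp\left(-z^2\left(\frac{\alpha_1}{\alpha_3}-\frac{\alpha_1}{\alpha_2}\right)\right)}{\operatorname{erf}\left(z\sqrt{\frac{\alpha_1}{\alpha_3}}\right)}-z\exp\left(z^2\tfrac{\alpha_1}{\alpha_2}\right)\qquad(z>0).$$ $z_0>0$ is the unique zero of the increasing function $H$, and $h_2=\frac{B-C}{A_\infty-B}\sqrt{\frac{k_2k_3c_2}{\pi c_3\alpha_3}}\frac{1}{\operatorname{erf}(z_0\sqrt{\alpha_1/\alpha_2})}$. Write $g(z)=\sqrt{\frac{\alpha_2}{\alpha_1}}\operatorname{erf}^{-1}(H(z))$ for $z\ge z_0$. Solution of (P1), existing and unique for $h_0>h_2$: free boundaries $w_i(t)=2\xi_i\sqrt{\alpha_1t}$, where $\xi_1$ is the unique solution in $(z_0,\infty)$ of $Q(z)=T(g(z))$ and $\xi_2=g(\xi_1)$; temperatures $v_3=\dfrac{\frac{Bk_3}{h_0\sqrt{\pi\alpha_3}}+A_\infty\operatorname{erf}(\xi_2\sqrt{\alpha_1/\alpha_3})-(A_\infty-B)\operatorname{erf}\left(\frac{x}{2\sqrt{\alpha_3t}}\right)}{\frac{k_3}{h_0\sqrt{\pi\alpha_3}}+\operatorname{erf}(\xi_2\sqrt{\alpha_1/\alpha_3})}$, $v_2=C+(B-C)\dfrac{\operatorname{erf}(\xi_1\sqrt{\alpha_1/\alpha_2})-\operatorname{erf}\left(\frac{x}{2\sqrt{\alpha_2t}}\right)}{\operatorname{erf}(\xi_1\sqrt{\alpha_1/\alpha_2})-\operatorname{erf}(\xi_2\sqrt{\alpha_1/\alpha_2})}$,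 $v_1=D+(C-D)\dfrac{\operatorname{erfc}\left(\frac{x}{2\sqrt{\alpha_1t}}\right)}{\operatorname{erfc}(\xi_1)}$. Solution of (P2), existing and unique for $A>B$: free boundaries $r_i(t)=2\mu_i\sqrt{\alpha_1t}$, where $\mu_1$ is the unique solution in $(z_0,\infty)$ of $Q(z)=V(g(z))$ and $\mu_2=g(\mu_1)$; temperatures $u_3=A-(A-B)\dfrac{\operatorname{erf}\left(\frac{x}{2\sqrt{\alpha_3t}}\right)}{\operatorname{erf}(\mu_2\sqrt{\alpha_1/\alpha_3})}$, and $u_2,u_1$ given by the formulas for $v_2,v_1$ with $\xi_i$ replaced by $\mu_i$. *)

(* Defs.v *)
From Stdlib Require Export Reals.
From Coquelicot Require Export Coquelicot.
Open Scope R_scope.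

Definition erf (z : R) : R :=
  2 / sqrt PI * RInt (fun u => exp (- u ^ 2)) 0 z.

Definition erfc (z : R) : R := 1 - erf z.

(* [ki], [ci], [rho], [l1], [l2] are the positive thermal constants and
   [TB], [TC], [TD] the temperatures B > C > D. *)
Record params : Type := Params {
  rho : R;
  k1 : R; k2 : R; k3 : R;
  c1 : R; c2 : R; c3 : R;
  l1 : R; l2 : R;
  TB : R; TC : R; TD : R
}.

Definition alpha1 (p : params) : R := k1 p / (rho p * c1 p).
Definition alpha2 (p : params) : R := k2 p / (rho p * c2 p).
Definition alpha3 (p : params) : R := k3 p / (rho p * c3 p).
Definition delta1 (p : params) : R := rho p * l1 p.
Definition delta2 (p : params) : R := rho p * l2 p.

Definition admissible (p : params) : Prop :=
  0 < rho p /\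
  (0 < k1 p /\ 0 < k2 p /\ 0 < k3 p) /\
  (0 < c1 p /\ 0 < c2 p /\ 0 < c3 p) /\
  (0 < l1 p /\ 0 < l2 p) /\
  alpha3 p < alpha2 p /\
  TD p < TC p < TB p.

Definition Ste1 (p : params) : R := c1 p * (TC p - TD p) / l1 p.
Definition Ste2 (p : params) : R := c2 p * (TB p - TC p) / l2 p.

Definition phi (p : params) (z : R) : R :=
  z + Ste1 p / sqrt PI * (exp (- z ^ 2) / erfc z).

Definition H (p : params) (z : R) : R :=
  erf (z * sqrt (alpha1 p / alpha2 p)) -
  Ste2 p / sqrt PI * (l2 p / l1 p) * sqrt (k2 p * c1 p / (k1 p * c2 p)) *
  (exp (- z ^ 2 * (alpha1 p / alpha2 p)) / phi p z).

Definition h2 (p : params) (z0 Ainf : R) : R :=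
  (TB p - TC p) / (Ainf - TB p) *
  sqrt (k2 p * k3 p * c2 p / (PI * c3 p * alpha3 p)) *
  (1 / erf (z0 * sqrt (alpha1 p / alpha2 p))).

(* Candidate solutions. The temperatures are total functions of (x, t), but
   only their values for t > 0 on the closed phase regions
     Phi3 : 0 <= x <= y2 t,   Phi2 : y2 t <= x <= y1 t,   Phi1 : y1 t <= x
   are ever constrained or compared. *)
Record candidate : Type := Candidate {
  Phi1 : R -> R -> R;
  Phi2 : R -> R -> R;
  Phi3 : R -> R -> R;
  y1 : R -> R;
  y2 : R -> R
}.

(* At the end points of a phase region the space derivative is one-sided,
   since the temperature is meaningless on the other side. *)
Definition is_right_derive (f : R -> R) (a l : R) : Prop :=
  filterlim (fun x => (f x - f a) / (x - a)) (at_right a) (locally l).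

Definition is_left_derive (f : R -> R) (a l : R) : Prop :=
  filterlim (fun x => (f x - f a) / (x - a)) (at_left a) (locally l).

(* [ex_derive] is required separately: [ex_derive_n _ 2] only speaks about the
   total function [Derive]. *)
Definition heat_equation (alpha : R) (Phi : R -> R -> R)
    (Omega : R -> R -> Prop) : Prop :=
  forall x t : R, 0 < t -> Omega x t ->
    ex_derive (fun z => Phi z t) x /\
    ex_derive_n (fun z => Phi z t) 2 x /\
    is_derive (fun s => Phi x s) t
      (alpha * Derive_n (fun z => Phi z t) 2 x).

Definition common_system (p : params) (s : candidate) : Prop :=
  heat_equation (alpha3 p) (Phi3 s) (fun x t => 0 < x < y2 s t) /\
  heat_equation (alpha2 p) (Phi2 s) (fun x t => y2 s t < x < y1 s t) /\
  heat_equation (alpha1 p) (Phi1 s) (fun x t => y1 s t < x) /\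
  (forall t, 0 < t ->
    Phi3 s (y2 s t) t = TB p /\ Phi2 s (y2 s t) t = TB p) /\
  (forall t, 0 < t ->
    Phi2 s (y1 s t) t = TC p /\ Phi1 s (y1 s t) t = TC p) /\
  (forall x, 0 < x ->
    filterlim (fun t => Phi1 s x t) (at_right 0) (locally (TD p))) /\
  (forall t, 0 < t -> is_lim (fun x => Phi1 s x t) p_infty (TD p)) /\
  (forall t, 0 < t -> exists q2 q3 v : R,
    is_right_derive (fun x => Phi2 s x t) (y2 s t) q2 /\
    is_left_derive (fun x => Phi3 s x t) (y2 s t) q3 /\
    is_derive (y2 s) t v /\
    k2 p * q2 - k3 p * q3 = delta2 p * v) /\
  (forall t, 0 < t -> exists q1 q2 v : R,
    is_right_derive (fun x => Phi1 s x t) (y1 s t) q1 /\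
    is_left_derive (fun x => Phi2 s x t) (y1 s t) q2 /\
    is_derive (y1 s) t v /\
    k1 p * q1 - k2 p * q2 = delta1 p * v) /\
  y1 s 0 = 0 /\ y2 s 0 = 0.

Definition solves_P1 (p : params) (h0 Ainf : R) (s : candidate) : Prop :=
  common_system p s /\
  (forall t, 0 < t -> exists q : R,
    is_right_derive (fun x => Phi3 s x t) 0 q /\
    k3 p * q = h0 / sqrt t * (Phi3 s 0 t - Ainf)).

Definition solves_P2 (p : params) (A : R) (s : candidate) : Prop :=
  common_system p s /\ (forall t, 0 < t -> Phi3 s 0 t = A).

Definition similarity_type (p : params) (s : candidate) (eta1 eta2 : R)
    : Prop :=
  0 < eta2 < eta1 /\
  (forall t, 0 <= t -> y1 s t = 2 * eta1 * sqrt (alpha1 p * t)) /\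
  (forall t, 0 <= t -> y2 s t = 2 * eta2 * sqrt (alpha1 p * t)) /\
  (exists A1 B1 : R, forall x t, 0 < t -> y1 s t <= x ->
    Phi1 s x t = A1 + B1 * erf (x / (2 * sqrt (alpha1 p * t)))) /\
  (exists A2 B2 : R, forall x t, 0 < t -> y2 s t <= x <= y1 s t ->
    Phi2 s x t = A2 + B2 * erf (x / (2 * sqrt (alpha2 p * t)))) /\
  (exists A3 B3 : R, forall x t, 0 < t -> 0 <= x <= y2 s t ->
    Phi3 s x t = A3 + B3 * erf (x / (2 * sqrt (alpha3 p * t)))).

Definition coincide (s s' : candidate) : Prop :=
  (forall t, 0 <= t -> y1 s t = y1 s' t) /\
  (forall t, 0 <= t -> y2 s t = y2 s' t) /\
  (forall x t, 0 < t -> y1 s t <= x -> Phi1 s x t = Phi1 s' x t) /\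
  (forall x t, 0 < t -> y2 s t <= x <= y1 s t -> Phi2 s x t = Phi2 s' x t) /\
  (forall x t, 0 < t -> 0 <= x <= y2 s t -> Phi3 s x t = Phi3 s' x t).

Definition similarity_solution (p : params) (P : candidate -> Prop)
    (s : candidate) : Prop :=
  P s /\ exists eta1 eta2 : R, similarity_type p s eta1 eta2.

Definition the_similarity_solution (p : params) (P : candidate -> Prop)
    (s : candidate) : Prop :=
  similarity_solution p P s /\
  forall s' : candidate, similarity_solution p P s' -> coincide s s'.

(* Main.v *)
Require Import Defs.
From Stdlib Require Import Lra.

(** The given solution [s] of one problem also satisfies the boundary condition
  of the other, since [Phi3 s 0 t] is constant in time; what has to be proved is
  that similarity solutions are unique. Evaluated at time 1, the conditions
  at the two free boundaries say that the flux constant [b] of the middle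
  phase satisfies [b = F eta1 = G eta2] with [F] increasing (because the Mills
  ratio [exp (z ^ 2) * erfc z] decreases) and [G] decreasing (because
  [alpha3 < alpha2]). A larger [eta1] would thus give a larger [b] and
  a smaller [eta2], i.e. a thicker middle phase, although the prescribed
  temperature drop across that phase makes [b] decrease with its thickness.

  The limit of [erf] at infinity is only used through its existence, so that
  the Gaussian integral need not be evaluated. *)

(** * The error function, its limit at infinity and the Mills ratio *)

Lemma is_derive_erf (z : R) : is_derive erf z (2 / sqrt PI * exp (- z ^ 2)).
Proof.
  apply (is_derive_scal (fun y => RInt (fun u => exp (- u ^ 2)) 0 y)).
  assert (Hc : forall y, continuous (fun u => exp (- u ^ 2)) y).
  { intros y. apply (ex_derive_continuous (K := R_AbsRing) (V := R_NormedModule)). auto_derive. exact I. }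
  apply (is_derive_RInt (V := R_NormedModule) (fun u => exp (- u ^ 2)) _ 0).
  - apply filter_forall. intros y. apply (RInt_correct (V := R_CompleteNormedModule)).
    apply (ex_RInt_continuous (V := R_CompleteNormedModule)). intros; apply Hc.
  - apply Hc.
Qed.

Lemma ex_derive_erf (z : R) : ex_derive erf z.
Proof. eexists; apply is_derive_erf. Qed.

Lemma Derive_erf (z : R) : Derive (fun x => erf x) z = 2 / sqrt PI * exp (- z ^ 2).
Proof. apply is_derive_unique, is_derive_erf. Qed.

Lemma sqrt_PI_pos : 0 < sqrt PI.
Proof. apply sqrt_lt_R0, PI_RGT_0. Qed.

Lemma erf_0 : erf 0 = 0.
Proof. unfold erf. rewrite RInt_point. unfold zero; simpl. ring. Qed.

Lemma nonneg_derive_le (f df : R -> R) (a b : R) :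
  a <= b -> (forall x, a <= x <= b -> is_derive f x (df x)) ->
  (forall x, a <= x <= b -> 0 <= df x) -> f a <= f b.
Proof.
  intros Hab Hd Hp.
  destruct (MVT_gen f a b df) as [x [Hx Hfx]].
  - rewrite Rmin_left, Rmax_right by lra. intros; apply Hd; lra.
  - rewrite Rmin_left, Rmax_right by lra. intros x Hx.
    apply continuity_pt_filterlim, (ex_derive_continuous (K := R_AbsRing) (V := R_NormedModule)).
    eexists. now apply Hd.
  - rewrite Rmin_left, Rmax_right in Hx by lra.
    specialize (Hp x Hx). nra.
Qed.

Lemma erf_increasing (x y : R) : x < y -> erf x < erf y.
Proof.
  intros Hxy.
  apply (incr_function erf m_infty p_infty (fun z => 2 / sqrt PI * exp (- z ^ 2)));
    try easy.
  - intros; apply is_derive_erf.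
  - intros z _ _. pose proof sqrt_PI_pos. pose proof (exp_pos (- z ^ 2)).
    apply Rmult_lt_0_compat; auto. apply Rdiv_lt_0_compat; lra.
Qed.

Lemma erf_nondecreasing (x y : R) : x <= y -> erf x <= erf y.
Proof. intros [Hlt | ->]; [left; now apply erf_increasing | apply Rle_refl]. Qed.

Lemma erf_pos (z : R) : 0 < z -> 0 < erf z.
Proof. intros Hz. rewrite <- erf_0. now apply erf_increasing. Qed.

(** This tail bound serves twice: with [z = 1] it shows that [erf] is bounded, and as [w] tends to
    infinity it gives the sign of the derivative of the Mills ratio. *)
Lemma erf_tail_le (z w : R) :
  z <= w -> z * (erf w - erf z) <= exp (- z ^ 2) / sqrt PI.
Proof.
  intros Hzw. pose proof sqrt_PI_pos.
  (* [exp (- w ^ 2) / sqrt PI + z * erf w] is nonincreasing in [w >= z]. *)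
  assert (Hm : - (exp (- z ^ 2) / sqrt PI + z * erf z)
               <= - (exp (- w ^ 2) / sqrt PI + z * erf w)).
  { apply (nonneg_derive_le (fun w => - (exp (- w ^ 2) / sqrt PI + z * erf w))
             (fun w => 2 / sqrt PI * exp (- w ^ 2) * (w - z))); auto.
    - intros x _. auto_derive.
      + apply ex_derive_erf.
      + rewrite Derive_erf. simpl. field. lra.
    - intros x Hx. pose proof (exp_pos (- x ^ 2)).
      assert (0 < 2 / sqrt PI) by (apply Rdiv_lt_0_compat; lra).
      apply Rmult_le_pos; [apply Rmult_le_pos|]; lra. }
  assert (0 < exp (- w ^ 2) / sqrt PI)
    by (apply Rdiv_lt_0_compat; auto; apply exp_pos).
  lra.
Qed.

Lemma erf_limit_exists :
  exists L : R, is_lim erf p_infty L /\ forall z, erf z < L.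
Proof.
  destruct (completeness (fun y => exists z, y = erf z)) as [L [Hub Hlub]].
  - exists (erf 1 + exp (- 1 ^ 2) / sqrt PI). intros y [z ->].
    (* The tail bound applies only beyond 1, so [z] is first raised to [Rmax 1 z]. *)
    pose proof (Rmax_l 1 z). pose proof (Rmax_r 1 z).
    pose proof (erf_tail_le 1 (Rmax 1 z) ltac:(lra)).
    pose proof (erf_nondecreasing z (Rmax 1 z) ltac:(lra)). lra.
  - now exists (erf 0), 0.
  - assert (HL : forall z, erf z < L).
    { intros z. apply Rlt_le_trans with (erf (z + 1)).
      - apply erf_increasing; lra.
      - apply Hub. now exists (z + 1). }
    exists L. split; auto.
    apply is_lim_spec. intros eps.
    destruct (Classical_Prop.classic (exists M, L - eps < erf M)) as [[M HM] | HM].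
    + exists M. intros x Hx. pose proof (erf_increasing M x Hx).
      specialize (HL x). apply Rabs_def1; lra.
    + assert (L <= L - eps).
      { apply Hlub. intros y [z ->]. apply Rnot_lt_le. intros Hz.
        apply HM. now exists z. }
      destruct eps as [e He]; simpl in *; lra.
Qed.

(** [erf_infty - erf z] plays the part of [erfc z]. Taking [real] loses nothing, because the limit
    is finite by [erf_limit_exists]. *)
Definition erf_infty : R := real (Lim erf p_infty).

Lemma is_lim_erf : is_lim erf p_infty erf_infty.
Proof.
  destruct erf_limit_exists as [L [HL _]]. unfold erf_infty.
  now rewrite (is_lim_unique _ _ _ HL).
Qed.

Lemma erf_lt_infty (z : R) : erf z < erf_infty.
Proof.
  destruct erf_limit_exists as [L [HL Hlt]]. unfold erf_infty.
  rewrite (is_lim_unique _ _ _ HL). apply Hlt.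
Qed.

Lemma erf_complement_le (z : R) :
  0 <= z -> z * (erf_infty - erf z) <= exp (- z ^ 2) / sqrt PI.
Proof.
  intros Hz.
  assert (Hl : is_lim (fun w => z * (erf w - erf z)) p_infty (z * (erf_infty - erf z))).
  { apply (is_lim_scal_l (fun w => erf w - erf z) z p_infty (erf_infty - erf z)).
    apply is_lim_minus'; [apply is_lim_erf | apply is_lim_const]. }
  apply (is_lim_le_loc (fun w => z * (erf w - erf z)) (fun _ => exp (- z ^ 2) / sqrt PI) p_infty
           (z * (erf_infty - erf z)) (exp (- z ^ 2) / sqrt PI)); auto.
  - exists z. intros w Hw. apply erf_tail_le. lra.
  - apply is_lim_const.
Qed.

(** The ratio [m] satisfies [m' = 2 * z * m - 2 / sqrt PI], and [erf_complement_le] multiplied by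
    [2 * exp (z ^ 2)] says that this is nonpositive. *)
Lemma mills_nonincreasing (x y : R) :
  0 <= x -> x <= y ->
  exp (y ^ 2) * (erf_infty - erf y) <= exp (x ^ 2) * (erf_infty - erf x).
Proof.
  intros Hx Hxy. apply Ropp_le_cancel.
  apply (nonneg_derive_le (fun z => - (exp (z ^ 2) * (erf_infty - erf z)))
    (fun z => 2 * exp (z ^ 2) * (exp (- z ^ 2) / sqrt PI - z * (erf_infty - erf z))));
    auto.
  - intros z _. pose proof sqrt_PI_pos. auto_derive.
    + apply ex_derive_erf.
    + rewrite Derive_erf. simpl. field. lra.
  - intros z Hz. pose proof (exp_pos (z ^ 2)).
    pose proof (erf_complement_le z ltac:(lra)).
    apply Rmult_le_pos; lra.
Qed.

(** * Monotonicity of the fluxes at the two free boundaries *)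

Lemma outer_flux_increasing (a r s x y : R) :
  0 < r -> 0 < s -> 0 <= x < y ->
  (r * x + s / (exp (x ^ 2) * (erf_infty - erf x))) * exp ((x * a) ^ 2) <
  (r * y + s / (exp (y ^ 2) * (erf_infty - erf y))) * exp ((y * a) ^ 2).
Proof.
  intros Hr Hs [Hx Hxy].
  assert (Hpos : forall z, 0 < exp (z ^ 2) * (erf_infty - erf z)).
  { intros z. apply Rmult_lt_0_compat; [apply exp_pos |].
    pose proof (erf_lt_infty z); lra. }
  assert (Hinv : forall z, 0 < s / (exp (z ^ 2) * (erf_infty - erf z))).
  { intros z. apply Rdiv_lt_0_compat; auto. }
  assert (Hm : s / (exp (x ^ 2) * (erf_infty - erf x)) <=
               s / (exp (y ^ 2) * (erf_infty - erf y))).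
  { apply Rmult_le_compat_l; [lra |].
    apply Rinv_le_contravar; auto. apply mills_nonincreasing; lra. }
  assert (He : exp ((x * a) ^ 2) <= exp ((y * a) ^ 2)).
  { assert ((x * a) ^ 2 <= (y * a) ^ 2) as [Hlt | ->]; [| left; now apply exp_increasing | lra].
    rewrite !Rpow_mult_distr. apply Rmult_le_compat_r; [apply pow2_ge_0 |].
    apply pow_incr; lra. }
  pose proof (exp_pos ((x * a) ^ 2)). pose proof (Hinv x).
  assert (0 <= r * x) by (apply Rmult_le_pos; lra).
  assert (r * x < r * y) by (apply Rmult_lt_compat_l; lra).
  apply Rlt_le_trans with
    ((r * y + s / (exp (y ^ 2) * (erf_infty - erf y))) * exp ((x * a) ^ 2)).
  - apply Rmult_lt_compat_r; lra.
  - apply Rmult_le_compat_l; lra.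
Qed.

(** The exponent is [x ^ 2 * (a ^ 2 - b ^ 2)] with [a < b], so the numerator falls while the
    denominator grows, and the subtracted term grows. Positivity of [x] keeps the denominator
    positive even for [kappa = 0]. *)
Lemma inner_flux_decreasing (a b r s kappa x y : R) :
  0 < a < b -> 0 < r -> 0 < s -> 0 <= kappa -> 0 < x < y ->
  s * exp ((y * a) ^ 2 - (y * b) ^ 2) / (kappa + erf (y * b))
    - r * y * exp ((y * a) ^ 2) <
  s * exp ((x * a) ^ 2 - (x * b) ^ 2) / (kappa + erf (x * b))
    - r * x * exp ((x * a) ^ 2).
Proof.
  intros Hab Hr Hs Hk Hxy.
  assert (Hxx : x ^ 2 < y ^ 2) by (simpl; nra).
  assert (Haa : 0 < a ^ 2 < b ^ 2) by (simpl; nra).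
  assert (He : exp ((x * a) ^ 2) < exp ((y * a) ^ 2)).
  { apply exp_increasing. rewrite !Rpow_mult_distr. nra. }
  assert (Hd : exp ((y * a) ^ 2 - (y * b) ^ 2) < exp ((x * a) ^ 2 - (x * b) ^ 2)).
  { apply exp_increasing. rewrite !Rpow_mult_distr. nra. }
  pose proof (exp_pos ((x * a) ^ 2)).
  pose proof (exp_pos ((y * a) ^ 2 - (y * b) ^ 2)).
  assert (Hx : 0 < erf (x * b)) by (apply erf_pos; nra).
  assert (Hy : erf (x * b) < erf (y * b)) by (apply erf_increasing; nra).
  assert (Hi : / (kappa + erf (y * b)) < / (kappa + erf (x * b))).
  { apply Rinv_lt_contravar; [apply Rmult_lt_0_compat |]; lra. }
  assert (0 < / (kappa + erf (y * b))) by (apply Rinv_0_lt_compat; lra).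
  assert (r * x * exp ((x * a) ^ 2) < r * y * exp ((y * a) ^ 2)).
  { apply Rmult_gt_0_lt_compat; nra. }
  assert (s * exp ((y * a) ^ 2 - (y * b) ^ 2) / (kappa + erf (y * b)) <
          s * exp ((x * a) ^ 2 - (x * b) ^ 2) / (kappa + erf (x * b))).
  { apply Rmult_gt_0_lt_compat; nra. }
  lra.
Qed.

(** * The algebraic system for the coefficients and its uniqueness *)

(* [exp (- (eta * sqrt (alpha1 / alpha)) ^ 2) / (sqrt PI * sqrt alpha)] is the
   slope at time 1 of [erf (x / (2 * sqrt (alpha * t)))] at the free boundary
   [x = 2 * eta * sqrt (alpha1 * t)]. The condition [A3 - kappa * B3 = M]
   is the temperature condition at [x = 0] for [kappa = 0], [M = A], and the
   convective one for [kappa = k3 / (h0 * sqrt (PI * alpha3))], [M = Ainf]. *)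
Definition coefficient_system (p : params) (kappa M eta1 eta2 : R)
    (A1 B1 A2 B2 A3 B3 : R) : Prop :=
  let a2 := sqrt (alpha1 p / alpha2 p) in
  let a3 := sqrt (alpha1 p / alpha3 p) in
  let m1 := k1 p / (sqrt PI * sqrt (alpha1 p)) in
  let m2 := k2 p / (sqrt PI * sqrt (alpha2 p)) in
  let m3 := k3 p / (sqrt PI * sqrt (alpha3 p)) in
  0 < eta2 < eta1 /\
  A1 + B1 * erf_infty = TD p /\ A1 + B1 * erf eta1 = TC p /\
  A2 + B2 * erf (eta1 * a2) = TC p /\ A2 + B2 * erf (eta2 * a2) = TB p /\
  A3 + B3 * erf (eta2 * a3) = TB p /\ A3 - kappa * B3 = M /\
  m2 * B2 * exp (- (eta2 * a2) ^ 2) - m3 * B3 * exp (- (eta2 * a3) ^ 2) =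
    delta2 p * sqrt (alpha1 p) * eta2 /\
  m1 * B1 * exp (- eta1 ^ 2) - m2 * B2 * exp (- (eta1 * a2) ^ 2) =
    delta1 p * sqrt (alpha1 p) * eta1.

Lemma alpha_pos (p : params) :
  admissible p -> 0 < alpha1 p /\ 0 < alpha2 p /\ 0 < alpha3 p.
Proof.
  intros (Hr & (? & ? & ?) & (? & ? & ?) & _).
  repeat split; apply Rdiv_lt_0_compat; try apply Rmult_lt_0_compat; auto.
Qed.

Lemma sqrt_alpha_ratio_lt (p : params) :
  admissible p ->
  0 < sqrt (alpha1 p / alpha2 p) < sqrt (alpha1 p / alpha3 p).
Proof.
  intros Hp. destruct (alpha_pos p Hp) as (? & ? & ?).
  destruct Hp as (_ & _ & _ & _ & Ha & _).
  assert (0 < alpha1 p / alpha2 p) by (apply Rdiv_lt_0_compat; auto).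
  split; [now apply sqrt_lt_R0 |].
  apply sqrt_lt_1_alt. split; [lra |].
  apply Rmult_lt_compat_l; auto.
  apply Rinv_lt_contravar; auto. now apply Rmult_lt_0_compat.
Qed.

Section Uniqueness.

Variables (p : params) (kappa M : R).
Hypotheses (hp : admissible p) (hkappa : 0 <= kappa) (hM : TB p < M).

Let a2 := sqrt (alpha1 p / alpha2 p).
Let a3 := sqrt (alpha1 p / alpha3 p).
Let m1 := k1 p / (sqrt PI * sqrt (alpha1 p)).
Let m2 := k2 p / (sqrt PI * sqrt (alpha2 p)).
Let m3 := k3 p / (sqrt PI * sqrt (alpha3 p)).

(** This is [delta1 p * sqrt (alpha1 p) * phi p z * exp ((z * a2) ^ 2)], with [erf_infty - erf z]
    for [erfc z]. It is what the outer Stefan condition gives for [m2 * - B2] once [B1] is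
    eliminated. *)
Let outer_flux (z : R) :=
  (delta1 p * sqrt (alpha1 p) * z
   + m1 * (TC p - TD p) / (exp (z ^ 2) * (erf_infty - erf z))) * exp ((z * a2) ^ 2).

(** The value of [m2 * - B2] given by the inner Stefan condition once [B3] is eliminated through the
    condition at [x = 0]. The parameters [kappa] and [M] cover both problems at once. *)
Let inner_flux (z : R) :=
  m3 * (M - TB p) * exp ((z * a2) ^ 2 - (z * a3) ^ 2) / (kappa + erf (z * a3))
  - delta2 p * sqrt (alpha1 p) * z * exp ((z * a2) ^ 2).

Lemma constants_pos :
  0 < m1 /\ 0 < m2 /\ 0 < m3 /\
  0 < delta1 p * sqrt (alpha1 p) /\ 0 < delta2 p * sqrt (alpha1 p).
Proof.
  destruct (alpha_pos p hp) as (? & ? & ?).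
  destruct hp as (? & (? & ? & ?) & _ & (? & ?) & _).
  pose proof sqrt_PI_pos.
  repeat split; unfold m1, m2, m3, delta1, delta2;
    repeat first [assumption | apply sqrt_lt_R0 | apply Rdiv_lt_0_compat
                 | apply Rmult_lt_0_compat].
Qed.

(** Subtracting the temperature conditions of a phase removes its additive constant and expresses
    [B1] and [B3] by temperature drops. Each Stefan condition, multiplied by the exponential at its
    boundary, then gives [m2 * - B2]. *)
Lemma coefficient_system_flux (eta1 eta2 A1 B1 A2 B2 A3 B3 : R) :
  coefficient_system p kappa M eta1 eta2 A1 B1 A2 B2 A3 B3 ->
  - B2 * (erf (eta1 * a2) - erf (eta2 * a2)) = TB p - TC p /\
  m2 * - B2 = outer_flux eta1 /\ m2 * - B2 = inner_flux eta2.
Proof.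
  intros (Heta & HD & HC1 & HC2 & HB2 & HB3 & HM & HS2 & HS1).
  fold a2 a3 m1 m2 m3 in HC2, HB2, HB3, HS2, HS1.
  assert (Ha : 0 < a3) by (unfold a3; pose proof (sqrt_alpha_ratio_lt p hp); lra).
  repeat split; [lra | |]; unfold outer_flux, inner_flux.
  - pose proof (erf_lt_infty eta1). pose proof (exp_pos (eta1 ^ 2)).
    pose proof (exp_pos ((eta1 * a2) ^ 2)).
    rewrite !exp_Ropp in HS1.
    replace (TC p - TD p) with (- B1 * (erf_infty - erf eta1)) by lra.
    rewrite <- HS1. field. lra.
  - assert (0 < erf (eta2 * a3)) by (apply erf_pos; nra).
    replace (M - TB p) with (- B3 * (kappa + erf (eta2 * a3))) by lra.
    pose proof (exp_pos ((eta2 * a2) ^ 2)). pose proof (exp_pos ((eta2 * a3) ^ 2)).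
    unfold Rminus at 2. rewrite exp_plus.
    rewrite !exp_Ropp in *. rewrite <- HS2. field. lra.
Qed.

(* If [eta1 < eta1'], the flux [- m2 * B2] is larger for the primed solution,
   since [outer_flux] increases. As [inner_flux] decreases, [eta2' < eta2]:
   the primed middle phase is wider and so carries the smaller flux. *)
Lemma outer_boundary_le
    (eta1 eta2 A1 B1 A2 B2 A3 B3 eta1' eta2' A1' B1' A2' B2' A3' B3' : R) :
  coefficient_system p kappa M eta1 eta2 A1 B1 A2 B2 A3 B3 ->
  coefficient_system p kappa M eta1' eta2' A1' B1' A2' B2' A3' B3' ->
  eta1' <= eta1.
Proof.
  intros Hs Hs'.
  destruct (coefficient_system_flux _ _ _ _ _ _ _ _ Hs) as (HB & HQ & HV).
  destruct (coefficient_system_flux _ _ _ _ _ _ _ _ Hs') as (HB' & HQ' & HV').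
  destruct Hs as (Heta & _), Hs' as (Heta' & _).
  destruct constants_pos as (? & ? & ? & ? & ?).
  pose proof (sqrt_alpha_ratio_lt p hp) as Ha. fold a2 a3 in Ha.
  assert (TD p < TC p < TB p) by apply hp.
  apply Rnot_lt_le. intros Hlt.
  assert (HQlt : outer_flux eta1 < outer_flux eta1')
    by (apply outer_flux_increasing; try lra; apply Rmult_lt_0_compat; lra).
  assert (- B2 < - B2') by nra.
  assert (eta2' < eta2).
  { apply Rnot_le_lt. intros [Hle | ->].
    - assert (inner_flux eta2' < inner_flux eta2)
        by (apply inner_flux_decreasing; try lra; apply Rmult_lt_0_compat; lra).
      lra.
    - lra. }
  assert (erf (eta1 * a2) < erf (eta1' * a2)) by (apply erf_increasing; nra).
  assert (erf (eta2' * a2) < erf (eta2 * a2)) by (apply erf_increasing; nra).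
  assert (erf (eta2 * a2) < erf (eta1 * a2)) by (apply erf_increasing; nra).
  assert (0 < - B2) by nra.
  (* Both sides equal [TB p - TC p], so this strict inequality is the contradiction. *)
  assert (- B2 * (erf (eta1 * a2) - erf (eta2 * a2)) <
          - B2' * (erf (eta1' * a2) - erf (eta2' * a2)))
    by (apply Rmult_gt_0_lt_compat; lra).
  lra.
Qed.

(** Using [outer_boundary_le] in both directions gives equal outer boundaries, hence equal fluxes;
    strict monotonicity of [inner_flux] then gives equal inner boundaries. The remaining equations
    are linear with nonzero determinants. *)
Lemma coefficient_system_unique
    (eta1 eta2 A1 B1 A2 B2 A3 B3 eta1' eta2' A1' B1' A2' B2' A3' B3' : R) :
  coefficient_system p kappa M eta1 eta2 A1 B1 A2 B2 A3 B3 ->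
  coefficient_system p kappa M eta1' eta2' A1' B1' A2' B2' A3' B3' ->
  (eta1 = eta1' /\ eta2 = eta2') /\
  (A1 = A1' /\ B1 = B1') /\ (A2 = A2' /\ B2 = B2') /\ (A3 = A3' /\ B3 = B3').
Proof.
  intros Hs Hs'.
  assert (E1 : eta1 = eta1') by (apply Rle_antisym; eapply outer_boundary_le; eassumption).
  subst eta1'.
  destruct (coefficient_system_flux _ _ _ _ _ _ _ _ Hs) as (HB & HQ & HV).
  destruct (coefficient_system_flux _ _ _ _ _ _ _ _ Hs') as (HB' & HQ' & HV').
  destruct Hs as (Heta & HD & HC1 & HC2 & HB2 & HB3 & HM & _).
  destruct Hs' as (Heta' & HD' & HC1' & HC2' & HB2' & HB3' & HM' & _).
  destruct constants_pos as (? & ? & ? & ? & ?).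
  pose proof (sqrt_alpha_ratio_lt p hp) as Ha.
  fold a2 a3 in Ha, HC2, HB2, HB3, HC2', HB2', HB3'.
  assert (E2 : eta2 = eta2').
  { destruct (Rtotal_order eta2 eta2') as [Hlt | [-> | Hlt]]; auto; exfalso.
    - assert (inner_flux eta2' < inner_flux eta2)
        by (apply inner_flux_decreasing; try lra; apply Rmult_lt_0_compat; lra).
      lra.
    - assert (inner_flux eta2 < inner_flux eta2')
        by (apply inner_flux_decreasing; try lra; apply Rmult_lt_0_compat; lra).
      lra. }
  subst eta2'.
  assert (EB2 : B2 = B2') by (apply (Rmult_eq_reg_l m2); lra).
  pose proof (erf_lt_infty eta1).
  assert (EB1 : B1 = B1') by (apply (Rmult_eq_reg_r (erf_infty - erf eta1)); lra).
  assert (0 < erf (eta2 * a3)) by (apply erf_pos; nra).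
  assert (EB3 : B3 = B3') by (apply (Rmult_eq_reg_r (kappa + erf (eta2 * a3))); lra).
  subst. repeat split; lra.
Qed.

End Uniqueness.

(** * From a similarity solution to its coefficient system *)

Lemma is_derive_erf_profile (A B alpha t x : R) :
  0 < alpha -> 0 < t ->
  is_derive (fun z => A + B * erf (z / (2 * sqrt (alpha * t)))) x
    (B * (exp (- (x / (2 * sqrt (alpha * t))) ^ 2) / (sqrt PI * sqrt (alpha * t)))).
Proof.
  intros Ha Ht. pose proof sqrt_PI_pos.
  assert (0 < sqrt (alpha * t)) by (apply sqrt_lt_R0, Rmult_lt_0_compat; auto).
  auto_derive.
  - apply ex_derive_erf.
  - rewrite Derive_erf. unfold Rdiv. field. lra.
Qed.

(** A temperature is given by its profile only on its closed phase region, so at a free boundary it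
    agrees with a differentiable function on one side only. This suffices for the one-sided
    derivative. *)
Lemma is_right_derive_ext (f g : R -> R) (a b l : R) :
  a < b -> (forall x, a <= x <= b -> f x = g x) ->
  is_derive g a l -> is_right_derive f a l.
Proof.
  intros Hab Hfg Hg. apply is_derive_Reals in Hg.
  intros P [eps HP]. destruct (Hg eps (cond_pos eps)) as [d Hd].
  assert (Hm : 0 < Rmin d (b - a)) by (apply Rmin_pos; [apply cond_pos | lra]).
  exists (mkposreal _ Hm). intros x Hx Hax. apply HP.
  pose proof (Rmin_l d (b - a)). pose proof (Rmin_r d (b - a)).
  assert (Habs : Rabs (x - a) < Rmin d (b - a)) by apply Hx.
  rewrite Rabs_pos_eq in Habs by lra.
  rewrite !Hfg by lra.
  specialize (Hd (x - a) ltac:(lra) ltac:(rewrite Rabs_pos_eq; lra)).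
  now rewrite Rplus_minus in Hd.
Qed.

Lemma is_left_derive_ext (f g : R -> R) (a b l : R) :
  b < a -> (forall x, b <= x <= a -> f x = g x) ->
  is_derive g a l -> is_left_derive f a l.
Proof.
  intros Hab Hfg Hg. apply is_derive_Reals in Hg.
  intros P [eps HP]. destruct (Hg eps (cond_pos eps)) as [d Hd].
  assert (Hm : 0 < Rmin d (a - b)) by (apply Rmin_pos; [apply cond_pos | lra]).
  exists (mkposreal _ Hm). intros x Hx Hax. apply HP.
  pose proof (Rmin_l d (a - b)). pose proof (Rmin_r d (a - b)).
  assert (Habs : Rabs (x - a) < Rmin d (a - b)) by apply Hx.
  rewrite Rabs_left in Habs by lra.
  rewrite !Hfg by lra.
  specialize (Hd (x - a) ltac:(lra) ltac:(rewrite Rabs_left; lra)).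
  now rewrite Rplus_minus in Hd.
Qed.

Lemma is_right_derive_unique (f : R -> R) (a l l' : R) :
  is_right_derive f a l -> is_right_derive f a l' -> l = l'.
Proof. apply (filterlim_locally_unique (K := R_AbsRing) (V := R_NormedModule) (F := at_right a)). Qed.

Lemma is_left_derive_unique (f : R -> R) (a l l' : R) :
  is_left_derive f a l -> is_left_derive f a l' -> l = l'.
Proof. apply (filterlim_locally_unique (K := R_AbsRing) (V := R_NormedModule) (F := at_left a)). Qed.

Lemma sqrt_boundary_speed (y : R -> R) (eta alpha v : R) :
  0 < alpha -> (forall t, 0 <= t -> y t = 2 * eta * sqrt (alpha * t)) ->
  is_derive y 1 v -> v = sqrt alpha * eta.
Proof.
  intros Ha Hy Hv.
  assert (Hd : is_derive y 1 (sqrt alpha * eta)).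
  { apply (is_derive_ext_loc (fun t => 2 * eta * (sqrt alpha * sqrt t))).
    (* Radius 1 around time 1 keeps [t] positive, where the formula for [y] holds. *)
    - exists (mkposreal 1 Rlt_0_1). intros t Ht.
      assert (Hb : Rabs (t - 1) < 1) by apply Ht. apply Rabs_def2 in Hb.
      rewrite Hy, sqrt_mult by lra. reflexivity.
    - auto_derive; [lra |]. rewrite sqrt_1. field. }
  rewrite <- (is_derive_unique _ _ _ Hd). symmetry. now apply is_derive_unique.
Qed.

(** The existential constants of [similarity_type] become parameters, so that equations between them
    can be stated. *)
Definition similarity_profile (p : params) (s : candidate)
    (eta1 eta2 A1 B1 A2 B2 A3 B3 : R) : Prop :=
  (forall t, 0 <= t -> y1 s t = 2 * eta1 * sqrt (alpha1 p * t)) /\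
  (forall t, 0 <= t -> y2 s t = 2 * eta2 * sqrt (alpha1 p * t)) /\
  (forall x t, 0 < t -> y1 s t <= x ->
    Phi1 s x t = A1 + B1 * erf (x / (2 * sqrt (alpha1 p * t)))) /\
  (forall x t, 0 < t -> y2 s t <= x <= y1 s t ->
    Phi2 s x t = A2 + B2 * erf (x / (2 * sqrt (alpha2 p * t)))) /\
  (forall x t, 0 < t -> 0 <= x <= y2 s t ->
    Phi3 s x t = A3 + B3 * erf (x / (2 * sqrt (alpha3 p * t)))).

Lemma similarity_type_profile (p : params) (s : candidate) (eta1 eta2 : R) :
  similarity_type p s eta1 eta2 ->
  0 < eta2 < eta1 /\
  exists A1 B1 A2 B2 A3 B3, similarity_profile p s eta1 eta2 A1 B1 A2 B2 A3 B3.
Proof.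
  intros (Heta & Hy1 & Hy2 & (A1 & B1 & H1) & (A2 & B2 & H2) & (A3 & B3 & H3)).
  split; auto. exists A1, B1, A2, B2, A3, B3. now repeat split.
Qed.

Lemma boundaries_ordered (p : params) (s : candidate)
    (eta1 eta2 A1 B1 A2 B2 A3 B3 t : R) :
  admissible p -> 0 < eta2 < eta1 ->
  similarity_profile p s eta1 eta2 A1 B1 A2 B2 A3 B3 ->
  0 < t -> 0 < y2 s t < y1 s t.
Proof.
  intros Hp Heta (Hy1 & Hy2 & _) Ht.
  destruct (alpha_pos p Hp) as (Ha & _).
  rewrite Hy1, Hy2 by lra.
  assert (0 < sqrt (alpha1 p * t)) by (apply sqrt_lt_R0, Rmult_lt_0_compat; lra).
  nra.
Qed.

Lemma similarity_variable (eta a b : R) :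
  0 < a -> 0 < b ->
  2 * eta * sqrt (a * 1) / (2 * sqrt (b * 1)) = eta * sqrt (a / b).
Proof.
  intros Ha Hb. rewrite !Rmult_1_r, sqrt_div_alt by lra.
  pose proof (sqrt_lt_R0 b Hb). field. lra.
Qed.

Lemma far_field_coefficients (p : params) (s : candidate)
    (eta1 eta2 A1 B1 A2 B2 A3 B3 T : R) :
  admissible p -> similarity_profile p s eta1 eta2 A1 B1 A2 B2 A3 B3 ->
  is_lim (fun x => Phi1 s x 1) p_infty T -> A1 + B1 * erf_infty = T.
Proof.
  intros Hp (_ & _ & H1 & _) Hlim.
  destruct (alpha_pos p Hp) as (Ha & _).
  assert (Hs : 0 < / (2 * sqrt (alpha1 p * 1))).
  { apply Rinv_0_lt_compat. pose proof (sqrt_lt_R0 (alpha1 p * 1)). lra. }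
  assert (Hl : is_lim (fun x => A1 + B1 * erf (x / (2 * sqrt (alpha1 p * 1)))) p_infty
                 (A1 + B1 * erf_infty)).
  { apply is_lim_plus'; [apply is_lim_const |].
    apply (is_lim_scal_l _ B1 p_infty erf_infty).
    apply (is_lim_comp erf _ p_infty erf_infty p_infty).
    - apply is_lim_erf.
    - pose proof (is_lim_scal_r (fun x => x) (/ (2 * sqrt (alpha1 p * 1)))
                    p_infty p_infty (is_lim_id _)) as Hx.
      (* [Rbar_mult] decides the sign of the finite factor; [Hs] leaves only the branch with value
         [p_infty]. *)
      replace p_infty with (Rbar_mult p_infty (/ (2 * sqrt (alpha1 p * 1)))) at 2; auto.
      simpl. destruct (Rle_dec 0 _) as [Hle | n]; [| lra].
      destruct (Rle_lt_or_eq_dec 0 _ Hle); auto; lra.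
    (* The inner function is finite and so never equals its limit [p_infty], as [is_lim_comp]
       requires. *)
    - now exists 0. }
  assert (Hl' : is_lim (fun x => Phi1 s x 1) p_infty (A1 + B1 * erf_infty)).
  { eapply is_lim_ext_loc; [| exact Hl].
    exists (y1 s 1). intros x Hx. symmetry. apply H1; lra. }
  pose proof (is_lim_unique _ _ _ Hl') as E. rewrite (is_lim_unique _ _ _ Hlim) in E.
  now injection E.
Qed.

(** All conditions are read at time 1. The Stefan conditions only assert that some slopes and speeds
    exist; uniqueness of derivatives identifies them with those of the profiles. *)
Lemma similarity_coefficients (p : params) (s : candidate)
    (kappa M eta1 eta2 A1 B1 A2 B2 A3 B3 : R) :
  admissible p -> common_system p s -> 0 < eta2 < eta1 ->
  similarity_profile p s eta1 eta2 A1 B1 A2 B2 A3 B3 ->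
  A3 - kappa * B3 = M ->
  coefficient_system p kappa M eta1 eta2 A1 B1 A2 B2 A3 B3.
Proof.
  intros Hp (_ & _ & _ & HB & HC & _ & HD & HS2 & HS1 & _) Heta Hprof HM.
  pose proof (boundaries_ordered _ _ _ _ _ _ _ _ _ _ 1 Hp Heta Hprof Rlt_0_1) as Hy.
  pose proof (far_field_coefficients _ _ _ _ _ _ _ _ _ _ _ Hp Hprof (HD 1 Rlt_0_1)) as HD1.
  destruct Hprof as (Hy1 & Hy2 & H1 & H2 & H3).
  destruct (alpha_pos p Hp) as (Ha1 & Ha2 & Ha3).
  pose proof (Hy1 1 Rle_0_1) as Ey1. pose proof (Hy2 1 Rle_0_1) as Ey2.
  destruct (HB 1 Rlt_0_1) as [HB3 HB2]. destruct (HC 1 Rlt_0_1) as [HC2 HC1].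
  rewrite H3 in HB3 by lra. rewrite H2 in HB2, HC2 by lra. rewrite H1 in HC1 by lra.
  destruct (HS2 1 Rlt_0_1) as (q2 & q3 & v2 & Hq2 & Hq3 & Hv2 & E2).
  destruct (HS1 1 Rlt_0_1) as (q1 & q2' & v1 & Hq1 & Hq2' & Hv1 & E1).
  rewrite (sqrt_boundary_speed _ _ _ _ Ha1 Hy2 Hv2) in E2.
  rewrite (sqrt_boundary_speed _ _ _ _ Ha1 Hy1 Hv1) in E1.
  rewrite (is_right_derive_unique _ _ _ _ Hq2
    (is_right_derive_ext _ _ _ (y1 s 1) _ (proj2 Hy) (fun x Hx => H2 x 1 Rlt_0_1 Hx)
      (is_derive_erf_profile A2 B2 _ _ _ Ha2 Rlt_0_1))) in E2.
  rewrite (is_left_derive_unique _ _ _ _ Hq3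
    (is_left_derive_ext _ _ _ 0 _ (proj1 Hy) (fun x Hx => H3 x 1 Rlt_0_1 Hx)
      (is_derive_erf_profile A3 B3 _ _ _ Ha3 Rlt_0_1))) in E2.
  rewrite (is_left_derive_unique _ _ _ _ Hq2'
    (is_left_derive_ext _ _ _ (y2 s 1) _ (proj2 Hy) (fun x Hx => H2 x 1 Rlt_0_1 Hx)
      (is_derive_erf_profile A2 B2 _ _ _ Ha2 Rlt_0_1))) in E1.
  (* The outer phase is unbounded, so any point to the right of the boundary can end the interval of
     agreement. *)
  assert (Hy1' : y1 s 1 < y1 s 1 + 1) by lra.
  rewrite (is_right_derive_unique _ _ _ _ Hq1
    (is_right_derive_ext _ _ _ _ _ Hy1' (fun x Hx => H1 x 1 Rlt_0_1 (proj1 Hx))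
      (is_derive_erf_profile A1 B1 _ _ _ Ha1 Rlt_0_1))) in E1.
  rewrite Ey1, Ey2, !similarity_variable in * by assumption.
  assert (E11 : sqrt (alpha1 p / alpha1 p) = 1).
  { unfold Rdiv. rewrite Rinv_r by lra. apply sqrt_1. }
  rewrite E11, !Rmult_1_r in *.
  repeat split; try assumption; try lra.
Qed.

(** * The conditions at the fixed face as equations between coefficients *)

(** Since [erf 0 = 0], the temperature at the fixed face is [A3] at all times. The term [0 * B3]
    gives the equation the shape used in [coefficient_system], with [kappa = 0]. *)
Lemma temperature_condition_iff (p : params) (s : candidate)
    (eta1 eta2 A1 B1 A2 B2 A3 B3 A : R) :
  admissible p -> 0 < eta2 < eta1 ->
  similarity_profile p s eta1 eta2 A1 B1 A2 B2 A3 B3 ->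
  (forall t, 0 < t -> Phi3 s 0 t = A) <-> A3 - 0 * B3 = A.
Proof.
  intros Hp Heta Hprof.
  assert (H0 : forall t, 0 < t -> Phi3 s 0 t = A3).
  { intros t Ht.
    pose proof (boundaries_ordered _ _ _ _ _ _ _ _ _ _ t Hp Heta Hprof Ht).
    destruct Hprof as (_ & _ & _ & _ & H3). rewrite H3 by lra.
    unfold Rdiv. rewrite Rmult_0_l, erf_0. ring. }
  split.
  - intros HA. rewrite <- (HA 1 Rlt_0_1), (H0 1 Rlt_0_1). ring.
  - intros <- t Ht. rewrite (H0 t Ht). ring.
Qed.

(** The slope of the profile at [x = 0] is proportional to [1 / sqrt t], as is the heat transfer
    coefficient. The time factor cancels, leaving one equation for all [t]. *)
Lemma convective_condition_iff (p : params) (s : candidate)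
    (h0 Ainf eta1 eta2 A1 B1 A2 B2 A3 B3 : R) :
  admissible p -> 0 < h0 -> 0 < eta2 < eta1 ->
  similarity_profile p s eta1 eta2 A1 B1 A2 B2 A3 B3 ->
  (forall t, 0 < t -> exists q : R,
    is_right_derive (fun x => Phi3 s x t) 0 q /\
    k3 p * q = h0 / sqrt t * (Phi3 s 0 t - Ainf))
  <-> A3 - k3 p / (h0 * sqrt (PI * alpha3 p)) * B3 = Ainf.
Proof.
  intros Hp Hh Heta Hprof.
  destruct (alpha_pos p Hp) as (_ & _ & Ha).
  pose proof sqrt_PI_pos. pose proof (sqrt_lt_R0 _ Ha). pose proof PI_RGT_0.
  assert (HA3 : forall t, 0 < t -> Phi3 s 0 t = A3).
  { intros t Ht. rewrite (proj2 (temperature_condition_iff _ _ _ _ _ _ _ _ _ _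
      (A3 - 0 * B3) Hp Heta Hprof) eq_refl t Ht). ring. }
  assert (Hq : forall t, 0 < t -> is_right_derive (fun x => Phi3 s x t) 0
                 (B3 / (sqrt PI * (sqrt (alpha3 p) * sqrt t)))).
  { intros t Ht.
    pose proof (boundaries_ordered _ _ _ _ _ _ _ _ _ _ t Hp Heta Hprof Ht) as Hy.
    destruct Hprof as (_ & _ & _ & _ & H3).
    pose proof (is_right_derive_ext _ _ _ (y2 s t) _ (proj1 Hy)
      (fun x Hx => H3 x t Ht Hx) (is_derive_erf_profile A3 B3 _ _ _ Ha Ht)) as Hd.
    replace (- (0 / (2 * sqrt (alpha3 p * t))) ^ 2) with 0 in Hd
      by (unfold Rdiv; ring).
    rewrite exp_0, sqrt_mult in Hd by lra.
    unfold Rdiv at 1 in Hd. now rewrite Rmult_1_l in Hd. }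
  rewrite sqrt_mult by lra. split.
  - intros Hc. destruct (Hc 1 Rlt_0_1) as (q & Hq1 & E).
    rewrite (is_right_derive_unique _ _ _ _ Hq1 (Hq 1 Rlt_0_1)) in E.
    rewrite (HA3 1 Rlt_0_1), sqrt_1 in E.
    (* [Ainf] is written through the right side of [E], so that [E] can replace it by the flux. *)
    replace Ainf with (A3 - / h0 * (h0 / 1 * (A3 - Ainf))) by (field; lra).
    rewrite <- E. field. lra.
  - intros <- t Ht. exists (B3 / (sqrt PI * (sqrt (alpha3 p) * sqrt t))).
    split; [now apply Hq |]. rewrite (HA3 t Ht).
    pose proof (sqrt_lt_R0 t Ht). field. lra.
Qed.

(** * Uniqueness of similarity solutions and the equivalence of the two problems *)

(** The common argument for both problems: only the values of [kappa] and [M] that encode the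
    condition at [x = 0] differ. *)
Lemma the_similarity_solution_intro (p : params) (P : candidate -> Prop)
    (kappa M : R) (s : candidate) :
  admissible p -> 0 <= kappa -> TB p < M ->
  (forall s' eta1 eta2 A1 B1 A2 B2 A3 B3, P s' -> 0 < eta2 < eta1 ->
    similarity_profile p s' eta1 eta2 A1 B1 A2 B2 A3 B3 ->
    common_system p s' /\ A3 - kappa * B3 = M) ->
  similarity_solution p P s -> the_similarity_solution p P s.
Proof.
  intros Hp Hk HM HP Hs. split; auto.
  intros s' (HP' & eta1' & eta2' & Ht').
  destruct Hs as (HPs & eta1 & eta2 & Ht).
  destruct (similarity_type_profile _ _ _ _ Ht)
    as (Heta & A1 & B1 & A2 & B2 & A3 & B3 & Hprof).
  destruct (similarity_type_profile _ _ _ _ Ht')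
    as (Heta' & A1' & B1' & A2' & B2' & A3' & B3' & Hprof').
  destruct (HP _ _ _ _ _ _ _ _ _ HPs Heta Hprof) as (Hsys & Hc).
  destruct (HP _ _ _ _ _ _ _ _ _ HP' Heta' Hprof') as (Hsys' & Hc').
  destruct (coefficient_system_unique p kappa M Hp Hk HM _ _ _ _ _ _ _ _ _ _ _ _ _ _ _ _
    (similarity_coefficients _ _ _ _ _ _ _ _ _ _ _ _ Hp Hsys Heta Hprof Hc)
    (similarity_coefficients _ _ _ _ _ _ _ _ _ _ _ _ Hp Hsys' Heta' Hprof' Hc'))
    as ((-> & ->) & (-> & ->) & (-> & ->) & (-> & ->)).
  destruct Hprof as (Hy1 & Hy2 & H1 & H2 & H3).
  destruct Hprof' as (Hy1' & Hy2' & H1' & H2' & H3').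
  repeat split.
  - intros t H. now rewrite Hy1, Hy1'.
  - intros t H. now rewrite Hy2, Hy2'.
  - intros x t H Hx. rewrite H1, H1'; auto. now rewrite Hy1', <- Hy1 by lra.
  - intros x t H Hx. rewrite H2, H2'; auto.
    now rewrite Hy1', Hy2', <- Hy1, <- Hy2 by lra.
  - intros x t H Hx. rewrite H3, H3'; auto. now rewrite Hy2', <- Hy2 by lra.
Qed.

Lemma the_similarity_solution_P1 (p : params) (h0 Ainf : R) (s : candidate) :
  admissible p -> 0 < h0 -> TB p < Ainf ->
  similarity_solution p (solves_P1 p h0 Ainf) s ->
  the_similarity_solution p (solves_P1 p h0 Ainf) s.
Proof.
  intros Hp Hh HA.
  destruct (alpha_pos p Hp) as (_ & _ & Ha).
  apply (the_similarity_solution_intro p _ (k3 p / (h0 * sqrt (PI * alpha3 p))) Ainf);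
    auto.
  - left. apply Rdiv_lt_0_compat; [apply Hp |].
    apply Rmult_lt_0_compat, sqrt_lt_R0, Rmult_lt_0_compat; auto. apply PI_RGT_0.
  - intros s' eta1 eta2 A1 B1 A2 B2 A3 B3 (Hsys & Hc) Heta Hprof. split; auto.
    now apply (convective_condition_iff _ _ _ _ _ _ _ _ _ _ _ _ Hp Hh Heta Hprof).
Qed.

Lemma the_similarity_solution_P2 (p : params) (A : R) (s : candidate) :
  admissible p -> TB p < A ->
  similarity_solution p (solves_P2 p A) s ->
  the_similarity_solution p (solves_P2 p A) s.
Proof.
  intros Hp HA.
  apply (the_similarity_solution_intro p _ 0 A); auto; [apply Rle_refl |].
  intros s' eta1 eta2 A1 B1 A2 B2 A3 B3 (Hsys & Hc) Heta Hprof. split; auto.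
  now apply (temperature_condition_iff _ _ _ _ _ _ _ _ _ _ _ Hp Heta Hprof).
Qed.

Lemma coincide_refl (s : candidate) : coincide s s.
Proof. repeat split. Qed.

Theorem theorem3p1 (p : params) (z0 : R) (hp : admissible p)
    (hz0 : 0 < z0) (hH : H p z0 = 0) :
  (forall (Ainf h0 : R) (s : candidate) (xi1 xi2 : R),
    TB p < Ainf -> 0 < h0 -> h2 p z0 Ainf < h0 ->
    solves_P1 p h0 Ainf s -> similarity_type p s xi1 xi2 ->
    let A :=
      (TB p * k3 p / (h0 * sqrt (PI * alpha3 p)) +
       Ainf * erf (xi2 * sqrt (alpha1 p / alpha3 p))) /
      (k3 p / (h0 * sqrt (PI * alpha3 p)) +
       erf (xi2 * sqrt (alpha1 p / alpha3 p))) in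
    TB p < A ->
    exists s' : candidate,
      the_similarity_solution p (solves_P2 p A) s' /\ coincide s' s)
  /\
  (forall (A Ainf : R) (s : candidate) (mu1 mu2 : R),
    TB p < A -> A < Ainf ->
    solves_P2 p A s -> similarity_type p s mu1 mu2 ->
    (A - TB p) / ((Ainf - A) * erf (mu2 * sqrt (alpha1 p / alpha3 p))) >
    (TB p - TC p) / (Ainf - TB p) * sqrt (k2 p * c2 p / (k3 p * c3 p)) *
    (1 / erf (z0 * sqrt (alpha1 p / alpha2 p))) ->
    let h0 :=
      k3 p / sqrt (alpha3 p * PI) * ((A - TB p) / (Ainf - A)) *
      (1 / erf (mu2 * sqrt (alpha1 p / alpha3 p))) in
    exists s' : candidate,
      the_similarity_solution p (solves_P1 p h0 Ainf) s' /\ coincide s' s).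
Proof.
  destruct (alpha_pos p hp) as (_ & _ & Ha).
  destruct (sqrt_alpha_ratio_lt p hp) as (Hr2 & Hr3).
  assert (Hk3 : 0 < k3 p) by apply hp.
  assert (Hs : 0 < sqrt (PI * alpha3 p))
    by (apply sqrt_lt_R0, Rmult_lt_0_compat; auto; apply PI_RGT_0).
  split.
  - intros Ainf h0 s xi1 xi2 HAinf Hh _ (Hsys & Hc) Ht A HA.
    destruct (similarity_type_profile _ _ _ _ Ht)
      as (Heta & A1 & B1 & A2 & B2 & A3 & B3 & Hprof).
    apply (convective_condition_iff _ _ _ _ _ _ _ _ _ _ _ _ hp Hh Heta Hprof) in Hc.
    destruct (similarity_coefficients _ _ _ _ _ _ _ _ _ _ _ _ hp Hsys Heta Hprof Hc)
      as (_ & _ & _ & _ & _ & HB & _).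
    assert (HE : 0 < erf (xi2 * sqrt (alpha1 p / alpha3 p))) by (apply erf_pos; nra).
    assert (0 < k3 p / (h0 * sqrt (PI * alpha3 p)))
      by (apply Rdiv_lt_0_compat; auto; now apply Rmult_lt_0_compat).
    (* With [kappa = k3 p / (h0 * sqrt (PI * alpha3 p))] and [E] the value of [erf] at the inner
       boundary, adding [kappa] times [HB] to [E] times [Hc] eliminates [B3] and leaves [A3 * (kappa
       + E) = kappa * TB p + E * Ainf]. So [A] is the face temperature of [s]. *)
    assert (EA : A3 - 0 * B3 = A).
    { unfold A. rewrite <- Hc, <- HB.
      pose proof (Rmult_lt_0_compat _ _ Hh Hs).
      pose proof (Rmult_lt_0_compat _ _ HE (Rmult_lt_0_compat _ _ Hh Hs)).
      field. repeat split; lra. }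
    clearbody A.
    pose proof (proj2 (temperature_condition_iff _ _ _ _ _ _ _ _ _ _ _ hp Heta Hprof) EA).
    exists s. split; [| apply coincide_refl].
    apply the_similarity_solution_P2; auto.
    split; [now split | now exists xi1, xi2].
  - intros A Ainf s mu1 mu2 HA HAinf (Hsys & Hc) Ht _ h0.
    destruct (similarity_type_profile _ _ _ _ Ht)
      as (Heta & A1 & B1 & A2 & B2 & A3 & B3 & Hprof).
    apply (temperature_condition_iff _ _ _ _ _ _ _ _ _ _ _ hp Heta Hprof) in Hc.
    destruct (similarity_coefficients _ _ _ _ _ _ _ _ _ _ _ _ hp Hsys Heta Hprof Hc)
      as (_ & _ & _ & _ & _ & HB & _).
    assert (HE : 0 < erf (mu2 * sqrt (alpha1 p / alpha3 p))) by (apply erf_pos; nra).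
    assert (Hh : 0 < h0).
    { unfold h0. rewrite (Rmult_comm (alpha3 p)).
      repeat apply Rmult_lt_0_compat; try apply Rinv_0_lt_compat; lra. }
    (* The choice of [h0] makes the factor of [B3] equal to [(Ainf - A) / (A - TB p)] times the
       value of [erf] at the inner boundary, so its product with [B3] is [A - Ainf]. *)
    assert (EA : A3 - k3 p / (h0 * sqrt (PI * alpha3 p)) * B3 = Ainf).
    { replace A3 with A by lra.
      replace B3 with (- (A - TB p) / erf (mu2 * sqrt (alpha1 p / alpha3 p)))
        by (rewrite <- HB, <- Hc; field; lra).
      unfold h0. rewrite (Rmult_comm (alpha3 p)). field. lra. }
    clearbody h0.
    pose proof (proj2 (convective_condition_iff _ _ _ _ _ _ _ _ _ _ _ _ hp Hh Heta Hprof) EA).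
    exists s. split; [| apply coincide_refl].
    apply the_similarity_solution_P1; auto; [lra |].
    split; [now split | now exists mu1, mu2].
Qed.
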